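(* Let $M$ be a PTR-submanifold of a Sasakian space form $\overline M(c)$, with totally real distribution $\mathcal D^\perp$ and ambiguous distribution $\widetilde{\mathcal D}$. For $X\in\Gamma(\widetilde{\mathcal D})$ and $Z\in\Gamma(\mathcal D^{\perp})$ one has $$g\bigl(\widetilde R(X,PX)Z,\phi Z\bigr)=-\frac{c-1}{2}\,\|PX\|^2\,\|Z\|^2 .$$
   Context: A Sasakian manifold $(\overline M^{2m+1},\phi,\xi,\eta,g)$ consists of a Riemannian metric $g$ with Levi-Civita connection $\widetilde\nabla$, a $(1,1)$-tensor field $\phi$, a vector field $\xi$ (the Reeb field) and a 1-form $\eta$ with $\phi^2X=-X+\eta(X)\xi$, $\eta(\xi)=1$, $\phi\xi=0$, $g(\phi X,\phi Y)=g(X,Y)-\eta(X)\eta(Y)$ and $(\widetilde\nabla_X\phi)Y=g(X,Y)\xi-\eta(Y)X$. A Sasakian space form $\overline M(c)$ is a Sasakian manifold of constant $\phi$-sectional curvature $c$; with the curvature convention used, its curvature tensor is $$\begin{aligned}\widetilde R(X,Y)Z={}&\tfrac{c+3}{4}\{g(Y,Z)X-g(X,Z)Y\}\\&+\tfrac{c-1}{4}\{g(X,\phi Z)\phi Y-g(Y,\phi Z)\phi X+2g(X,\phi Y)\phi Z\}\\&+\tfrac{c-1}{4}\{\eta(X)\eta(Z)Y-\eta(Y)\eta(Z)X+g(X,Z)\eta(Y)\xi-g(Y,Z)\eta(X)\xi\}.\end{aligned}$$ Let $M$ be an immersed submanifold with $\xi\in\Gamma(TM)$. For $X\in TM$ write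 $\phi X=PX+FX$ with $PX$ tangent and $FX$ normal. A PTR (partially totally real) submanifold is such an $M$ with a chosen nonzero constant-rank distribution $\mathcal D^{\perp}\subset TM\cap\ker\eta$ satisfying $\phi\mathcal D^{\perp}\subset T^{\perp}M$. The ambiguous distribution $\widetilde{\mathcal D}$ is the orthogonal complement of $\mathcal D^{\perp}\oplus\langle\xi\rangle$ in $TM$. *)

(* Defs.v *)
From HB Require Import structures.
From mathcomp Require Import all_boot all_order all_algebra.
From mathcomp Require Import all_classical all_reals all_analysis.
From mathcomp Require Import ring.
Set Implicit Arguments.
Unset Strict Implicit.
Unset Printing Implicit Defensive.
Import Order.TTheory GRing.Theory Num.Theory.
Import numFieldNormedType.Exports.
Local Open Scope classical_set_scope.
Local Open Scope ring_scope.

Definition partial (R : realType) (n : nat) (i : 'I_n) (f : 'rV[R]_n -> R)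
    : 'rV[R]_n -> R :=
  fun x => 'D_(delta_mx 0 i) f x.

Fixpoint Ck (R : realType) (n k : nat) (U : set 'rV[R]_n)
    (f : 'rV[R]_n -> R) : Prop :=
  (forall x, U x -> {for x, continuous f}) /\
  if k is k'.+1 then
    forall i : 'I_n,
      (forall x, U x -> derivable f x (delta_mx 0 i)) /\ Ck k' U (partial i f)
  else True.

Definition Cinf (R : realType) (n : nat) (U : set 'rV[R]_n)
    (f : 'rV[R]_n -> R) : Prop :=
  forall k, Ck k U f.

(** [cinv] is only meaningful on the open set [cmap @` cdom]. *)
Record chart (R : realType) (n : nat) (T : topologicalType) := Chart {
  cdom : set T ;
  cmap : T -> 'rV[R]_n ;
  cinv : 'rV[R]_n -> T ;
  cdom_open : open cdom ;
  cimg_open : open (cmap @` cdom) ;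
  cmapK : {in cdom, cancel cmap cinv} ;
  cmap_cont : {within cdom, continuous cmap} ;
  cinv_cont : {within cmap @` cdom, continuous cinv} }.

Definition chart_compat (R : realType) (n : nat) (T : topologicalType)
    (c c' : chart R n T) : Prop :=
  forall j : 'I_n,
    Cinf (cmap c @` (cdom c `&` cdom c')) (fun x => cmap c' (cinv c x) 0 j).

Record manifold (R : realType) (n : nat) := Manifold {
  carrier :> topologicalType ;
  manifold_hausdorff : hausdorff_space carrier ;
  manifold_second_countable : @second_countable carrier ;
  atlas : set (chart R n carrier) ;
  atlas_cover : forall p : carrier, exists2 c, atlas c & cdom c p ;
  atlas_compat : forall c c', atlas c -> atlas c' -> chart_compat c c' }.

Definition smooth (R : realType) (n : nat) (M : manifold R n) (f : M -> R)
    : Prop :=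
  forall c, atlas c -> Cinf (cmap c @` cdom c) (f \o cinv c).

Lemma Ck_ext (R : realType) (n k : nat) (U : set 'rV[R]_n) f g :
  open U -> (forall x, U x -> f x = g x) -> Ck k U f -> Ck k U g.
Proof.
move=> oU; elim: k f g => [|k IH] f g fg.
all: have nfg x : U x -> \near x, f x = g x by
  move=> Ux; apply: filterS (open_nbhs_nbhs (conj oU Ux)) => y /fg.
all: have cfg x : U x -> {for x, continuous f} -> {for x, continuous g} by
  move=> Ux; rewrite /prop_for /continuous_at -(fg x Ux);
  apply: cvg_trans; move=> P; apply: filterS2 (nfg x Ux) => y /= <-.
all: case=> cf Hf; split=> [x Ux|]; first exact: cfg (cf x Ux).
  by [].
move=> i; have [df Hi] := Hf i; split.
  by move=> x Ux; apply: near_eq_derivable (df x Ux); exact: nfg.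
by apply: IH Hi => x Ux; apply: near_eq_derive; exact: nfg.
Qed.

Lemma CkS (R : realType) (n k : nat) (U : set 'rV[R]_n) f :
  Ck k.+1 U f -> Ck k U f.
Proof.
elim: k f => [|k IH] f; first by case.
move=> [cf Hf]; split=> // i; have [df Hi] := Hf i.
by split => //; exact: IH.
Qed.

Lemma Ck_cst (R : realType) (n k : nat) (U : set 'rV[R]_n) (a : R) :
  Ck k U (cst a).
Proof.
have ca b x : U x -> {for x, continuous (@cst 'rV[R]_n R b)}.
  by move=> _; exact: cst_continuous.
elim: k a => [|k IH] a; first by split => // x; exact: ca.
split=> [x|i]; first exact: ca.
split=> [x _|]; first exact: derivable_cst.
suff -> : partial i (cst a) = cst 0 by exact: IH.
by apply/funext => x; exact: derive_cst.
Qed.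

Lemma CkD (R : realType) (n k : nat) (U : set 'rV[R]_n) f g :
  open U -> Ck k U f -> Ck k U g -> Ck k U (f + g).
Proof.
move=> oU; elim: k f g => [|k IH] f g [cf Hf] [cg Hg].
  by split=> // x Ux; apply: continuousD; [exact: cf | exact: cg].
split=> [x Ux|i]; first by apply: continuousD; [exact: cf | exact: cg].
have [df Hfi] := Hf i; have [dg Hgi] := Hg i.
split=> [x Ux|]; first by apply: derivableD; [exact: df | exact: dg].
apply: Ck_ext (IH _ _ Hfi Hgi) => // x Ux.
by rewrite /partial deriveD//; [exact: df | exact: dg].
Qed.

Lemma CkM (R : realType) (n k : nat) (U : set 'rV[R]_n) f g :
  open U -> Ck k U f -> Ck k U g -> Ck k U (f * g).
Proof.
move=> oU; elim: k f g => [|k IH] f g Cf Cg.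
  have [cf _] := Cf; have [cg _] := Cg.
  by split=> // x Ux; apply: continuousM; [exact: cf | exact: cg].
have Cf' := CkS Cf; have Cg' := CkS Cg.
have [cf Hf] := Cf; have [cg Hg] := Cg.
split=> [x Ux|i]; first by apply: continuousM; [exact: cf | exact: cg].
have [df Hfi] := Hf i; have [dg Hgi] := Hg i.
split=> [x Ux|]; first by apply: derivableM; [exact: df | exact: dg].
apply: Ck_ext (CkD oU (IH _ _ Cf' Hgi) (IH _ _ Cg' Hfi)) => // x Ux.
by rewrite /partial deriveM//; [exact: df | exact: dg].
Qed.

Definition smooth_pred (R : realType) (n : nat) (M : manifold R n) :
  {pred (M -> R)} := fun f => `[< smooth f >].

Lemma smooth_cst (R : realType) (n : nat) (M : manifold R n) (a : R) :
  smooth (cst a : M -> R).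
Proof. by move=> c Ac k; exact: Ck_cst. Qed.

Lemma smoothD (R : realType) (n : nat) (M : manifold R n) (f g : M -> R) :
  smooth f -> smooth g -> smooth (f + g).
Proof.
by move=> Hf Hg c Ac k; exact: CkD (@cimg_open _ _ _ c) (Hf c Ac k) (Hg c Ac k).
Qed.

Lemma smoothM (R : realType) (n : nat) (M : manifold R n) (f g : M -> R) :
  smooth f -> smooth g -> smooth (f * g).
Proof.
by move=> Hf Hg c Ac k; exact: CkM (@cimg_open _ _ _ c) (Hf c Ac k) (Hg c Ac k).
Qed.

Lemma smooth_lin (R : realType) (n : nat) (M : manifold R n) (a : R)
    (f g : M -> R) :
  smooth f -> smooth g -> smooth (a *: f + g).
Proof.
by move=> Hf Hg; exact: smoothD (smoothM (@smooth_cst _ _ _ a) Hf) Hg.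
Qed.

Lemma smooth_subring (R : realType) (n : nat) (M : manifold R n) :
  GRing.subring_closed (@smooth_pred R n M).
Proof.
split=> [|f g /asboolP Hf /asboolP Hg|f g /asboolP Hf /asboolP Hg].
- exact/asboolP/smooth_cst.
- by apply/asboolP; rewrite addrC -scaleN1r; exact: smooth_lin.
- exact/asboolP/smoothM.
Qed.

Lemma smooth_submod (R : realType) (n : nat) (M : manifold R n) :
  GRing.scaler_closed (@smooth_pred R n M).
Proof.
move=> a f /asboolP Hf; apply/asboolP.
exact: smoothM (@smooth_cst _ _ _ a) Hf.
Qed.

HB.instance Definition _ (R : realType) (n : nat) (M : manifold R n) :=
  GRing.isSubringClosed.Build (M -> R) (@smooth_pred R n M)
    (@smooth_subring R n M).
HB.instance Definition _ (R : realType) (n : nat) (M : manifold R n) :=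
  GRing.isScaleClosed.Build R (M -> R) (@smooth_pred R n M)
    (@smooth_submod R n M).

Record sfun (R : realType) (n : nat) (M : manifold R n) := Sfun {
  sfun_val :> M -> R ;
  sfun_valP : sfun_val \in @smooth_pred R n M }.

HB.instance Definition _ (R : realType) (n : nat) (M : manifold R n) :=
  [isSub for (@sfun_val R n M)].
HB.instance Definition _ (R : realType) (n : nat) (M : manifold R n) :=
  [Choice of (sfun M) by <:].
HB.instance Definition _ (R : realType) (n : nat) (M : manifold R n) :=
  GRing.SubChoice_isSubComPzRing.Build _ _ (sfun M) (subringClosedP _).
HB.instance Definition _ (R : realType) (n : nat) (M : manifold R n) :=
  [SubZmodule_isSubLmodule of (sfun M) by <:].

Lemma sfunP (R : realType) (n : nat) (M : manifold R n) (f : sfun M) :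
  smooth f.
Proof. exact/asboolP/(sfun_valP f). Qed.

Definition mk_sfun (R : realType) (n : nat) (M : manifold R n) (f : M -> R)
  (sf : smooth f) : sfun M := Sfun (introT (asboolP (smooth f)) sf).

Definition derivation_at (R : realType) (n : nat) (M : manifold R n) (q : M)
    (v : sfun M -> R) : Prop :=
  (forall (a : R) (f g : sfun M), v (a *: f + g) = a * v f + v g) /\
  (forall f g : sfun M, v (f * g) = f q * v g + v f * g q).

Definition derivation_at_pred (R : realType) (n : nat) (M : manifold R n)
  (q : M) : {pred (sfun M -> R)} := fun v => `[< derivation_at q v >].

Lemma derivation_at_submod (R : realType) (n : nat) (M : manifold R n)
  (q : M) : GRing.submod_closed (derivation_at_pred q).
Proof.
split=> [|a u v /asboolP [ul uM] /asboolP [vl vM]]; apply/asboolP.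
  by split=> *; rewrite /= ?mulr0 ?mul0r ?addr0.
split=> [b f g|f g] /=; rewrite !fctE /=.
  by rewrite /GRing.scale/= ul vl; ring.
by rewrite /GRing.scale/= uM vM; ring.
Qed.

HB.instance Definition _ (R : realType) (n : nat) (M : manifold R n) (q : M) :=
  GRing.isSubmodClosed.Build R (sfun M -> R) (@derivation_at_pred R n M q)
    (derivation_at_submod q).

Record tangent (R : realType) (n : nat) (M : manifold R n) (q : M) := Tangent {
  tangent_val :> sfun M -> R ;
  tangent_valP : tangent_val \in derivation_at_pred q }.

HB.instance Definition _ (R : realType) (n : nat) (M : manifold R n) (q : M) :=
  [isSub for (@tangent_val R n M q)].
HB.instance Definition _ (R : realType) (n : nat) (M : manifold R n) (q : M) :=
  [Choice of (tangent q) by <:].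
HB.instance Definition _ (R : realType) (n : nat) (M : manifold R n) (q : M) :=
  [SubChoice_isSubLmodule of (tangent q) by <:].

Lemma tangentP (R : realType) (n : nat) (M : manifold R n) (q : M)
  (v : tangent q) : derivation_at q v.
Proof. exact/asboolP/(tangent_valP v). Qed.

Definition mk_tangent (R : realType) (n : nat) (M : manifold R n) (q : M)
    (v : sfun M -> R) (dv : derivation_at q v) : tangent q :=
  Tangent (introT (asboolP (derivation_at q v)) dv).

(** Vector fields are derivations of the algebra of smooth functions.  The value
    [X \at q] of a field at a point is the tangent vector [h |-> (X h) q], and
      a family of tangent vectors is a vector field as soon as it sends smooth
    functions to smooth functions, see [mk_vfield]. *)

Definition derivation (R : realType) (n : nat) (M : manifold R n)
    (X : sfun M -> sfun M) : Prop :=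
  (forall (a : R) (f g : sfun M), X (a *: f + g) = a *: X f + X g) /\
  (forall f g : sfun M, X (f * g) = f * X g + X f * g).

Definition derivation_pred (R : realType) (n : nat) (M : manifold R n) :
  {pred (sfun M -> sfun M)} := fun X => `[< derivation X >].

Lemma derivation_submod (R : realType) (n : nat) (M : manifold R n) :
  GRing.submod_closed (@derivation_pred R n M).
Proof.
split=> [|a X Y /asboolP [Xl XM] /asboolP [Yl YM]]; apply/asboolP.
  by split=> *; rewrite /= ?mulr0 ?mul0r ?scaler0 ?addr0.
split=> [b f g|f g]; apply/val_inj/funext => p; rewrite !fctE /=.
  by rewrite Xl Yl /= !fctE /= /GRing.scale/=; ring.
by rewrite XM YM /= !fctE /= /GRing.scale/=; ring.
Qed.

HB.instance Definition _ (R : realType) (n : nat) (M : manifold R n) :=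
  GRing.isSubmodClosed.Build R (sfun M -> sfun M) (@derivation_pred R n M)
    (@derivation_submod R n M).

Record vfield (R : realType) (n : nat) (M : manifold R n) := Vfield {
  vfield_val :> sfun M -> sfun M ;
  vfield_valP : vfield_val \in @derivation_pred R n M }.

HB.instance Definition _ (R : realType) (n : nat) (M : manifold R n) :=
  [isSub for (@vfield_val R n M)].
HB.instance Definition _ (R : realType) (n : nat) (M : manifold R n) :=
  [Choice of (vfield M) by <:].
HB.instance Definition _ (R : realType) (n : nat) (M : manifold R n) :=
  [SubChoice_isSubLmodule of (vfield M) by <:].

Lemma vfieldP (R : realType) (n : nat) (M : manifold R n) (X : vfield M) :
  derivation X.
Proof. exact/asboolP/(vfield_valP X). Qed.

Definition mk_derivation (R : realType) (n : nat) (M : manifold R n)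
    (X : sfun M -> sfun M) (dX : derivation X) : vfield M :=
  Vfield (introT (asboolP (derivation X)) dX).

Lemma value_derivation (R : realType) (n : nat) (M : manifold R n)
  (X : vfield M) (q : M) : derivation_at q (fun h => X h q).
Proof. by have [Xl XM] := vfieldP X; split=> *; rewrite ?Xl ?XM. Qed.

Definition vfield_at (R : realType) (n : nat) (M : manifold R n)
  (X : vfield M) (q : M) : tangent q := mk_tangent (value_derivation X q).

Notation "X '\at' q" := (vfield_at X q)
  (at level 10, q at level 9, no associativity, format "X  '\at'  q") : ring_scope.

Definition smooth_section (R : realType) (n : nat) (M : manifold R n)
    (X : forall q : M, tangent q) : Prop :=
  forall h : sfun M, smooth (fun q => X q h).

Lemma section_derivation (R : realType) (n : nat) (M : manifold R n)
    (X : forall q : M, tangent q) (sX : smooth_section X) :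
  derivation (fun h => mk_sfun (sX h)).
Proof.
split=> *; apply/val_inj/funext => q; have [Xl XM] := tangentP (X q).
  exact: Xl.
exact: XM.
Qed.

Definition mk_vfield (R : realType) (n : nat) (M : manifold R n)
    (X : forall q : M, tangent q) (sX : smooth_section X) : vfield M :=
  mk_derivation (section_derivation sX).

Lemma fscale_derivation (R : realType) (n : nat) (M : manifold R n)
  (f : sfun M) (X : vfield M) : derivation (fun h => f * X h).
Proof.
have [Xl XM] := vfieldP X.
split=> *; apply/val_inj/funext => q; rewrite ?Xl ?XM /= !fctE /=.
  by rewrite /GRing.scale/=; ring.
by ring.
Qed.

Definition fscale (R : realType) (n : nat) (M : manifold R n)
  (f : sfun M) (X : vfield M) : vfield M :=
  mk_derivation (fscale_derivation f X).

Notation "f *^ X" := (fscale f X) (at level 40) : ring_scope.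

Lemma lie_derivation (R : realType) (n : nat) (M : manifold R n)
  (X Y : vfield M) : derivation (fun h => X (Y h) - Y (X h)).
Proof.
have [Xl XM] := vfieldP X; have [Yl YM] := vfieldP Y.
have XD f g : X (f + g) = X f + X g by rewrite -[f]scale1r Xl !scale1r.
have YD f g : Y (f + g) = Y f + Y g by rewrite -[f]scale1r Yl !scale1r.
split=> [a f g|f g].
  by rewrite Yl !Xl Yl scalerBr opprD addrACA.
rewrite XM YM XD YD !XM !YM; apply/val_inj/funext => q; rewrite /= !fctE /=.
by ring.
Qed.

Definition lie (R : realType) (n : nat) (M : manifold R n)
  (X Y : vfield M) : vfield M := mk_derivation (lie_derivation X Y).

Record one_form (R : realType) (n : nat) (M : manifold R n) := OneForm {
  form_at :> forall q : M, {scalar tangent q} ;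
  form_smooth : forall X : vfield M, smooth (fun q => form_at q (X \at q)) }.

Definition form_app (R : realType) (n : nat) (M : manifold R n)
  (a : one_form M) (X : vfield M) : sfun M := mk_sfun (form_smooth a X).

Record tensor11 (R : realType) (n : nat) (M : manifold R n) := Tensor11 {
  endo_at :> forall q : M, {linear tangent q -> tangent q} ;
  endo_smooth : forall X : vfield M, smooth_section (fun q => endo_at q (X \at q)) }.

Definition endo_app (R : realType) (n : nat) (M : manifold R n)
  (t : tensor11 M) (X : vfield M) : vfield M := mk_vfield (endo_smooth t X).

Record riem_metric (R : realType) (n : nat) (M : manifold R n) := RiemMetric {
  metric_at :> forall q : M, tangent q -> tangent q -> R ;
  metric_linear : forall (q : M) (a : R) (u v w : tangent q),
    metric_at (a *: u + v) w = a * metric_at u w + metric_at v w ;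
  metric_sym : forall (q : M) (u v : tangent q), metric_at u v = metric_at v u ;
  metric_pos : forall (q : M) (u : tangent q), u != 0 -> 0 < metric_at u u ;
  metric_smooth : forall X Y : vfield M,
    smooth (fun q => metric_at (X \at q) (Y \at q)) }.

Definition metric_app (R : realType) (n : nat) (M : manifold R n)
    (g : riem_metric M) (X Y : vfield M) : sfun M :=
  mk_sfun (metric_smooth g X Y).

Definition riem_norm (R : realType) (n : nat) (M : manifold R n)
  (g : riem_metric M) (q : M) (u : tangent q) : R := Num.sqrt (g q u u).

Record connection (R : realType) (n : nat) (M : manifold R n) := Connection {
  cov :> vfield M -> vfield M -> vfield M ;
  cov_linearl : forall (f : sfun M) (X Y Z : vfield M),
    cov (f *^ X + Y) Z = f *^ cov X Z + cov Y Z ;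
  cov_addr : forall X Y Z : vfield M, cov X (Y + Z) = cov X Y + cov X Z ;
  cov_leibniz : forall (f : sfun M) (X Y : vfield M),
    cov X (f *^ Y) = X f *^ Y + f *^ cov X Y }.

Definition levi_civita (R : realType) (n : nat) (M : manifold R n)
    (g : riem_metric M) (D : connection M) : Prop :=
  (forall X Y : vfield M, D X Y - D Y X = lie X Y) /\
  (forall X Y Z : vfield M,
     X (metric_app g Y Z) = metric_app g (D X Y) Z + metric_app g Y (D X Z)).

Definition curvature (R : realType) (n : nat) (M : manifold R n)
    (D : connection M) (X Y Z : vfield M) : vfield M :=
  D X (D Y Z) - D Y (D X Z) - D (lie X Y) Z.

(** The curvature tensor evaluated on tangent vectors: [r = R(u,v)w] in the
    tangent space at [q].  As for every tensor field, it is computed on vector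
    fields extending [u], [v] and [w]; such fields exist (the manifold is
    Hausdorff and locally Euclidean) and [r] does not depend on their choice. *)
Definition curvature_at (R : realType) (n : nat) (M : manifold R n)
    (D : connection M) (q : M) (u v w r : tangent q) : Prop :=
  exists X Y Z : vfield M,
    [/\ X \at q = u, Y \at q = v, Z \at q = w & curvature D X Y Z \at q = r].

Record sasakian (R : realType) (m : nat) (N : manifold R (2 * m).+1) :=
  Sasakian {
  smetric : riem_metric N ;
  sconn : connection N ;
  sphi : tensor11 N ;
  sxi : vfield N ;
  seta : one_form N ;
  sconnP : levi_civita smetric sconn ;
  sphi_sq : forall (q : N) (u : tangent q),
    sphi q (sphi q u) = - u + seta q u *: (sxi \at q) ;
  seta_xi : forall q : N, seta q (sxi \at q) = 1 ;
  sphi_xi : forall q : N, sphi q (sxi \at q) = 0 ;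
  smetric_phi : forall (q : N) (u v : tangent q),
    smetric q (sphi q u) (sphi q v) = smetric q u v - seta q u * seta q v ;
  scov_phi : forall X Y : vfield N,
    sconn X (endo_app sphi Y) - endo_app sphi (sconn X Y) =
      metric_app smetric X Y *^ sxi - form_app seta Y *^ X }.

(** Sectional curvature of the plane spanned by [u] and [v], where [r] stands
    for R(u,v)v; the [phi]-sectional curvature is the case [v = phi u]. *)
Definition sectional (R : realType) (n : nat) (M : manifold R n)
    (g : riem_metric M) (q : M) (u v r : tangent q) : R :=
  g q r u / (g q u u * g q v v - g q u v ^+ 2).

Definition space_form (R : realType) (m : nat) (N : manifold R (2 * m).+1)
    (S : sasakian N) (c : R) : Prop :=
  forall (q : N) (u r : tangent q),
    u != 0 -> seta S q u = 0 ->
    curvature_at (sconn S) u (sphi S q u) (sphi S q u) r ->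
    sectional (smetric S) u (sphi S q u) r = c.

Record smap (R : realType) (k n : nat) (M : manifold R k) (N : manifold R n) :=
  Smap {
  smap_val :> M -> N ;
  smap_cont : continuous smap_val ;
  smap_smooth : forall h : sfun N, smooth (h \o smap_val) }.

Definition pullback (R : realType) (k n : nat) (M : manifold R k)
  (N : manifold R n) (f : smap M N) (h : sfun N) : sfun M :=
  mk_sfun (smap_smooth f h).

Lemma differential_derivation (R : realType) (k n : nat) (M : manifold R k)
  (N : manifold R n) (f : smap M N) (p : M) (v : tangent p) :
  derivation_at (f p) (fun h => v (pullback f h)).
Proof.
have [vl vM] := tangentP v; split=> [a h h'|h h']; rewrite -?vl -?vM.
  by congr (tangent_val v _); apply/val_inj.
rewrite -[h (f p)]/(pullback f h p) -[h' (f p)]/(pullback f h' p) -vM.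
by congr (tangent_val v _); apply/val_inj.
Qed.

Definition differential (R : realType) (k n : nat) (M : manifold R k)
    (N : manifold R n) (f : smap M N) (p : M) (v : tangent p) :
    tangent (f p) :=
  mk_tangent (differential_derivation f v).

Record immersion (R : realType) (k n : nat) (M : manifold R k)
    (N : manifold R n) := Immersion {
  imm_map :> smap M N ;
  imm_inj : forall p : M, injective (@differential R k n M N imm_map p) }.

Definition normal_vector (R : realType) (k n : nat) (M : manifold R k)
    (N : manifold R n) (g : riem_metric N) (f : immersion M N) (p : M)
    (w : tangent (f p)) : Prop :=
  forall v : tangent p, g (f p) w (differential f v) = 0.

(** A smooth distribution of constant rank [r] is locally spanned by [r]
    pointwise linearly independent vector fields. *)
Definition distribution (R : realType) (k : nat) (M : manifold R k) (r : nat)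
    (D : forall p : M, set (tangent p)) : Prop :=
  forall p : M, exists E : 'I_r -> vfield M, \forall q \near p,
    (forall v : tangent q,
       D q v <-> exists a : 'I_r -> R, v = \sum_(i < r) a i *: (E i \at q)) /\
    (forall a : 'I_r -> R,
       \sum_(i < r) a i *: (E i \at q) = 0 -> forall i, a i = 0).

Definition section_of (R : realType) (k : nat) (M : manifold R k)
    (D : forall p : M, set (tangent p)) (X : vfield M) : Prop :=
  forall p : M, D p (X \at p).

Record phi_split (R : realType) (k m : nat) (M : manifold R k)
    (N : manifold R (2 * m).+1) (S : sasakian N) (f : immersion M N) :=
  PhiSplit {
  phiP : forall p : M, tangent p -> tangent p ;
  phiF : forall p : M, tangent p -> tangent (f p) ;
  phi_splitP : forall (p : M) (v : tangent p),
    sphi S (f p) (differential f v) = differential f (phiP v) + phiF v ;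
  phiF_normal : forall (p : M) (v : tangent p),
    normal_vector (smetric S) (phiF v) }.

Record ptr (R : realType) (k m : nat) (M : manifold R k)
    (N : manifold R (2 * m).+1) (S : sasakian N) (f : immersion M N) := Ptr {
  ptr_xi : forall p : M, exists v : tangent p,
    differential f v = sxi S \at (f p) ;
  ptr_rank : nat ;
  ptr_rank_gt0 : (0 < ptr_rank)%N ;
  ptr_perp : forall p : M, set (tangent p) ;
  ptr_perp_distribution : distribution ptr_rank ptr_perp ;
  ptr_perp_eta : forall (p : M) (v : tangent p),
    ptr_perp v -> seta S (f p) (differential f v) = 0 ;
  ptr_perp_phi : forall (p : M) (v : tangent p),
    ptr_perp v -> normal_vector (smetric S) (sphi S (f p) (differential f v)) }.

Definition ambiguous (R : realType) (k m : nat) (M : manifold R k)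
    (N : manifold R (2 * m).+1) (S : sasakian N) (f : immersion M N)
    (A : ptr S f) (p : M) : set (tangent p) :=
  [set u | smetric S (f p) (differential f u) (sxi S \at (f p)) = 0 /\
     forall v : tangent p, ptr_perp A v ->
       smetric S (f p) (differential f u) (differential f v) = 0].

(* Main.v *)
Require Import Defs.
From mathcomp Require Import all_boot all_order all_algebra.
From mathcomp Require Import all_classical all_reals all_analysis.
From mathcomp Require Import ring lra.
Set Implicit Arguments.
Unset Strict Implicit.
Unset Printing Implicit Defensive.
Import Order.TTheory GRing.Theory Num.Theory.
Import numFieldNormedType.Exports.
Import Defs.
Local Open Scope classical_set_scope.
Local Open Scope ring_scope.

(** The identity is the component $(X, PX, Z, \phi Z)$ of the curvature tensor
    of a Sasakian space form.  The vectors $X$, $PX$ and $Z$ all lie in the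
    contact distribution $\ker\eta$, so only the restriction of the curvature to
    $\ker\eta$ matters.  Write $\kappa$ for [constant4], the curvature of the unit
    sphere.  The Ricci identity for $\phi$, together with
    $\widetilde\nabla_X\xi = -\phi X$, says that on $\ker\eta$ the difference
    $\widetilde R - \kappa$ is invariant under $\phi$ in its last two arguments
    ([curvature_phi]), that is, $\widetilde R - \kappa$ has all the symmetries of
    a Kaehler curvature tensor.  Its holomorphic sectional curvature is $c - 1$,
    and a Kaehler curvature tensor is determined by its holomorphic sectional
    curvature ([kaehler_eq0]); hence $\widetilde R - \kappa$ is $(c-1)/4$ times
    the model tensor [holomorphic4].  This is [horizontal_curvature].

    Substituting $(X, PX, Z, \phi Z)$, every term of the model tensors with a
    factor $g(X, Z)$, $g(X, \phi Z)$ or $g(PX, \phi Z)$ vanishes, since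
    $X \perp \mathcal D^\perp$ and $\phi Z$ is normal.  What remains is
    $\frac{c-1}{2}\, g(X, \phi PX)\, \|\phi Z\|^2$, where
    $\|\phi Z\| = \|Z\|$ and $g(X, \phi PX) = -g(\phi X, PX) = -\|PX\|^2$.

    The curvature is handled as a quadrilinear form on vector fields, evaluated at a
    fixed point $q$.  That this form depends only on the values of its arguments
    at $q$ needs no extension of vectors to fields: it is clear for the last
    argument, which enters through the metric, and the curvature symmetries
    exchange the last argument with each of the others ([cl_local]).  The
    only fields that occur are those given with the curvature vector, their
    images under $\phi$, and sums of these. *)

(** * Algebraic curvature tensors *)

(** Additivity is asked in one argument only; the symmetries give it in the
    other three. *)
Record curvature_like (V : zmodType) (R : realFieldType)
    (B : V -> V -> V -> V -> R) : Prop := CurvatureLike {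
  clDl : forall X X' Y Z W, B (X + X') Y Z W = B X Y Z W + B X' Y Z W ;
  cl_skewl : forall X Y Z W, B X Y Z W = - B Y X Z W ;
  cl_skewr : forall X Y Z W, B X Y Z W = - B X Y W Z ;
  cl_bianchi : forall X Y Z W, B X Y Z W + B Y Z X W + B Z X Y W = 0 }.

Lemma curvature_like_lin (V : zmodType) (R : realFieldType)
    (T T1 T2 : V -> V -> V -> V -> R) (a : R) :
  curvature_like T -> curvature_like T1 -> curvature_like T2 ->
  curvature_like (fun X Y Z W => T X Y Z W - T1 X Y Z W - a * T2 X Y Z W).
Proof.
move=> [d l r b] [d1 l1 r1 b1] [d2 l2 r2 b2];
split=> [*|X Y Z W|X Y Z W|X Y Z W].
- by rewrite d d1 d2; ring.
- by rewrite l l1 l2; ring.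
- by rewrite r r1 r2; ring.
- transitivity (T X Y Z W + T Y Z X W + T Z X Y W
    - (T1 X Y Z W + T1 Y Z X W + T1 Z X Y W)
    - a * (T2 X Y Z W + T2 Y Z X W + T2 Z X Y W)); first by ring.
  by rewrite b b1 b2; ring.
Qed.

Section CurvatureLike.
Variables (V : zmodType) (R : realFieldType) (B : V -> V -> V -> V -> R).
Hypothesis cB : curvature_like B.

(** Milnor's octahedron: the four Bianchi identities below involve only six
    components up to sign, and the two components at stake appear in opposite
    combinations. *)
Lemma cl_pair X Y Z W : B X Y Z W = B Z W X Y.
Proof.
have := (cl_bianchi cB X Y Z W, cl_bianchi cB Y Z W X,
         cl_bianchi cB Z W X Y, cl_bianchi cB W X Y Z).
have sl := cl_skewl cB; have sr := cl_skewr cB.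
rewrite (sr Y Z W X) (sr Z W Y X) (sl W Y Z X) (sl W X Z Y) (sr X W Z Y).
rewrite (sl X Z W Y) (sr Z X W Y) (sl W X Y Z) (sr X Y W Z) (sr Y W X Z).
by move=> [[[a b] c] d]; lra.
Qed.

Lemma clDr X Y Z W Y' : B X (Y + Y') Z W = B X Y Z W + B X Y' Z W.
Proof. by rewrite !(cl_skewl cB X) (clDl cB) opprD. Qed.

Lemma clD3 X Y Z W Z' : B X Y (Z + Z') W = B X Y Z W + B X Y Z' W.
Proof. by rewrite !(cl_pair X Y) (clDl cB). Qed.

Lemma clD4 X Y Z W W' : B X Y Z (W + W') = B X Y Z W + B X Y Z W'.
Proof. by rewrite !(cl_pair X Y) clDr. Qed.

Lemma clNl X Y Z W : B (- X) Y Z W = - B X Y Z W.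
Proof.
have B0 : B 0 Y Z W = 0 by have := clDl cB 0 0 Y Z W; rewrite addr0; lra.
by have := clDl cB X (- X) Y Z W; rewrite subrr B0; lra.
Qed.

Lemma clNr X Y Z W : B X (- Y) Z W = - B X Y Z W.
Proof. by rewrite !(cl_skewl cB X) clNl. Qed.

Lemma clN3 X Y Z W : B X Y (- Z) W = - B X Y Z W.
Proof. by rewrite !(cl_pair X Y) clNl. Qed.

Lemma clN4 X Y Z W : B X Y Z (- W) = - B X Y Z W.
Proof. by rewrite !(cl_pair X Y) clNr. Qed.

Definition cl_add := (clDl cB, clDr, clD3, clD4).
Definition cl_opp := (clNl, clNr, clN3, clN4).

(** Tensoriality for free.  With [e] the relation of having the same value at a
    point, locality in the last argument is evident for [g(R(X,Y)Z,W)], and the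
    pair symmetry carries it to the first one. *)
Lemma cl_local (e : V -> V -> Prop) :
  (forall X Y Z W W', e W W' -> B X Y Z W = B X Y Z W') ->
  forall X X' Y Z W, e X X' -> B X Y Z W = B X' Y Z W.
Proof.
move=> B4 X X' Y Z W eX.
rewrite (cl_pair X) (cl_pair X') (cl_skewr cB Z W X) (cl_skewr cB Z W X').
by rewrite (B4 _ _ _ _ _ eX).
Qed.

(** Sectional curvatures determine the tensor.  Polarising twice, [B] becomes
    antisymmetric under each exchange of two of its arguments; the three terms of
    the Bianchi identity are then equal, so each of them is zero. *)
Lemma cl_eq0 (H : V -> Prop) (HD : forall X Y, H X -> H Y -> H (X + Y)) :
  (forall X Y, H X -> H Y -> B X Y Y X = 0) ->
  forall X Y Z W, H X -> H Y -> H Z -> H W -> B X Y Z W = 0.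
Proof.
move=> K0.
have K1 X Y Z : H X -> H Y -> H Z -> B X Y Z X = 0.
  move=> hX hY hZ; have := K0 X (Y + Z) hX (HD _ _ hY hZ).
  rewrite !cl_add !K0 // (cl_pair X Z) (cl_skewl cB) (cl_skewr cB).
  by lra.
have K2 X Y Z W : H X -> H Y -> H Z -> H W -> B X Y Z W = - B W Y Z X.
  move=> hX hY hZ hW; have := K1 (X + W) Y Z (HD _ _ hX hW) hY hZ.
  by rewrite !cl_add !K1 //; lra.
have cyc X Y Z W : H X -> H Y -> H Z -> H W -> B Y Z X W = B X Y Z W.
  move=> hX hY hZ hW; rewrite cl_pair (cl_skewr cB) K2 // opprK.
  by rewrite (cl_skewl cB) -K2.
move=> X Y Z W hX hY hZ hW.
have := cl_bianchi cB X Y Z W.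
by rewrite -(cyc Z X Y W) // (cyc X Y Z W) //; lra.
Qed.

(** The identity $J^2 = -1$ enters only through [B] and on [H], because on a
    Sasakian manifold $\phi^2 = -1$ holds only for the values at a point of the
    vector fields that are horizontal at that point. *)
Variables (H : V -> Prop) (J : V -> V).
Hypothesis HD : forall X Y, H X -> H Y -> H (X + Y).
Hypothesis HN : forall X, H X -> H (- X).
Hypothesis HJ : forall X, H X -> H (J X).
Hypothesis JD : {morph J : X Y / X + Y}.
Hypothesis JN : {morph J : X / - X}.
Hypothesis BJJ : forall X Y Z W, H X -> B (J (J X)) Y Z W = - B X Y Z W.
Hypothesis BJ :
  forall X Y Z W, H Z -> H W -> B X Y (J Z) (J W) = B X Y Z W.

(** A Kaehler curvature tensor is determined by its holomorphic sectional
    curvature.  Write $K(A,Z) = B(A,Z,Z,A)$.  The part of bidegree $(2,2)$ of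
    $B(X,JX,JX,X) = 0$ at $X = Z \pm A$ reads $K(A,Z) + 3K(A,JZ) = 0$; together
    with the same identity for $JZ$ in place of $Z$ it gives $K = 0$. *)
Lemma kaehler_eq0 :
  (forall X, H X -> B X (J X) (J X) X = 0) ->
  forall X Y Z W, H X -> H Y -> H Z -> H W -> B X Y Z W = 0.
Proof.
move=> Q0.
have BJ' X Y Z W : H X -> H Y -> B (J X) (J Y) Z W = B X Y Z W.
  by move=> hX hY; rewrite cl_pair BJ // cl_pair.
have BJJ2 X Y Z W : H Y -> B X (J (J Y)) Z W = - B X Y Z W.
  by move=> hY; rewrite !(cl_skewl cB X) BJJ.
have BJJ3 X Y Z W : H Z -> B X Y (J (J Z)) W = - B X Y Z W.
  by move=> hZ; rewrite !(cl_pair X Y) BJJ.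
have K3 A Z : H A -> H Z -> B A Z Z A + 3 * B A (J Z) (J Z) A = 0.
  move=> hA hZ.
  have hJA := HJ hA; have hJZ := HJ hZ.
  have := (Q0 _ (HD hZ hA), Q0 _ (HD hZ (HN hA))).
  (* the sum of the two expansions leaves only the terms of bidegree (2,2) *)
  rewrite !JD !JN !cl_add !cl_opp !Q0 //.
  have t3 : B A (J Z) (J A) Z = B A (J Z) (J Z) A.
    by rewrite -(BJ _ _ hJA hZ) BJJ3 // (cl_skewr cB A) opprK.
  have t2 : B Z (J A) (J Z) A = B A (J Z) (J Z) A.
    by rewrite cl_pair (cl_skewl cB) (cl_skewr cB) opprK t3.
  have t1 : B Z (J A) (J A) Z = B A (J Z) (J Z) A.
    by rewrite -(BJ' _ _ _ _ hZ hJA) BJJ2 // (cl_skewl cB) opprK t3.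
  have t4 : B A (J A) (J Z) Z = B A Z Z A + B A (J Z) (J Z) A.
    have := cl_bianchi cB A (J A) (J Z) Z.
    rewrite (cl_skewl cB (J Z) A) t3 BJ' // (cl_skewr cB A Z).
    by lra.
  have t5 : B Z (J Z) (J A) A = B A (J A) (J Z) Z.
    by rewrite cl_pair (cl_skewl cB) (cl_skewr cB) opprK.
  by rewrite t1 t2 t3 t5 t4 => -[a b]; lra.
apply: cl_eq0 => // A Z hA hZ.
have := (K3 _ _ hA hZ, K3 _ _ hA (HJ hZ)).
by rewrite BJJ2 // BJJ3 // opprK => -[]; lra.
Qed.

End CurvatureLike.

(** * The Riemannian curvature tensor at a point *)

Section Fields.
Variables (R : realType) (n : nat) (M : manifold R n).
Implicit Types (X Y Z W : vfield M) (f h : sfun M) (q : M).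

Lemma sfun_ext f h : (forall q, f q = h q) -> f = h.
Proof. by move=> fh; apply/val_inj/funext. Qed.

Lemma sfun_addE f h q : (f + h) q = f q + h q. Proof. by []. Qed.
Lemma sfun_oppE f q : (- f) q = - f q. Proof. by []. Qed.
Lemma sfun_mulE f h q : (f * h) q = f q * h q. Proof. by []. Qed.
Lemma sfun_zeroE q : (0 : sfun M) q = 0. Proof. by []. Qed.
Definition sfunE := (sfun_zeroE, sfun_addE, sfun_oppE, sfun_mulE).

Lemma vfield_ext X Y : (forall q, X \at q = Y \at q) -> X = Y.
Proof.
move=> XY; apply/val_inj/funext => h; apply: sfun_ext => q.
exact: (congr1 (fun v : tangent q => v h) (XY q)).
Qed.

Lemma at_add X Y q : (X + Y) \at q = X \at q + Y \at q.
Proof. by apply/val_inj/funext. Qed.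
Lemma at_opp X q : (- X) \at q = - (X \at q).
Proof. by apply/val_inj/funext. Qed.
Lemma at_fscale f X q : (fscale f X) \at q = f q *: (X \at q).
Proof. by apply/val_inj/funext. Qed.
Lemma at_endo (t : tensor11 M) X q : endo_app t X \at q = t q (X \at q).
Proof. by apply/val_inj/funext. Qed.

Lemma vfield_add X f h : X (f + h) = X f + X h.
Proof. by have [Xl _] := vfieldP X; rewrite -[f]scale1r Xl !scale1r. Qed.

Lemma vfield_opp X f : X (- f) = - X f.
Proof.
have X0 : X 0 = 0 by apply: (addIr (X 0)); rewrite -vfield_add !add0r.
by apply: (addIr (X f)); rewrite -vfield_add !addNr.
Qed.

Lemma vfield_addE X Y h : (X + Y) h = X h + Y h. Proof. by []. Qed.
Lemma vfield_oppE X h : (- X) h = - X h. Proof. by []. Qed.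
Lemma lieE X Y h : lie X Y h = X (Y h) - Y (X h). Proof. by []. Qed.
Lemma vfield_zeroE h : (0 : vfield M) h = 0. Proof. by []. Qed.
Definition vfieldE := (vfield_zeroE, vfield_addE, vfield_oppE, lieE).

Lemma fscale1 X : fscale 1 X = X.
Proof. by apply: vfield_ext => q; rewrite at_fscale scale1r. Qed.

End Fields.

(** A linear identity between iterated derivatives is checked on a function, at
    a point, where it becomes a ring identity. *)
Ltac vfield_ring :=
  apply/val_inj/funext => ?; apply: sfun_ext => ?;
  rewrite -?[val _]/(vfield_val _) ?vfieldE ?vfield_add ?vfield_opp ?sfunE;
  ring.

Section Lie.
Variables (R : realType) (n : nat) (M : manifold R n).
Implicit Types (X Y Z : vfield M).

Lemma lie_skew X Y : lie X Y = - lie Y X.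
Proof. by vfield_ring. Qed.

Lemma lie_addl X X' Y : lie (X + X') Y = lie X Y + lie X' Y.
Proof. by vfield_ring. Qed.

Lemma jacobi X Y Z : lie X (lie Y Z) + lie Y (lie Z X) + lie Z (lie X Y) = 0.
Proof. by vfield_ring. Qed.

End Lie.

Section Connection.
Variables (R : realType) (n : nat) (M : manifold R n) (D : connection M).
Implicit Types (X Y Z W : vfield M).

Lemma covDl X Y Z : D (X + Y) Z = D X Z + D Y Z.
Proof. by rewrite -{1}[X]fscale1 cov_linearl fscale1. Qed.
Lemma covNl X Z : D (- X) Z = - D X Z.
Proof.
have D0 : D 0 Z = 0 by apply: (addIr (D 0 Z)); rewrite -covDl !add0r.
by apply: (addIr (D X Z)); rewrite -covDl !addNr.
Qed.
Lemma covNr X Z : D X (- Z) = - D X Z.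
Proof.
have D0 : D X 0 = 0 by apply: (addIr (D X 0)); rewrite -cov_addr !add0r.
by apply: (addIr (D X Z)); rewrite -cov_addr !addNr.
Qed.
End Connection.

Section Metric.
Variables (R : realType) (n : nat) (M : manifold R n) (g : riem_metric M).

Lemma metricDl q (u v w : tangent q) : g q (u + v) w = g q u w + g q v w.
Proof. by rewrite -[u]scale1r metric_linear mul1r scale1r. Qed.
Lemma metric0l q (w : tangent q) : g q 0 w = 0.
Proof. by have := metricDl 0 0 w; rewrite addr0; lra. Qed.
Lemma metricZl q a (u w : tangent q) : g q (a *: u) w = a * g q u w.
Proof. by rewrite -[_ *: u]addr0 metric_linear metric0l addr0. Qed.
Lemma metricNl q (u w : tangent q) : g q (- u) w = - g q u w.
Proof. by rewrite -scaleN1r metricZl mulN1r. Qed.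
Lemma metric0r q (w : tangent q) : g q w 0 = 0.
Proof. by rewrite metric_sym metric0l. Qed.
Lemma metricDr q (u v w : tangent q) : g q w (u + v) = g q w u + g q w v.
Proof. by rewrite !(metric_sym g w) metricDl. Qed.
Lemma metricZr q a (u w : tangent q) : g q w (a *: u) = a * g q w u.
Proof. by rewrite !(metric_sym g w) metricZl. Qed.
Lemma metricNr q (u w : tangent q) : g q w (- u) = - g q w u.
Proof. by rewrite !(metric_sym g w) metricNl. Qed.
Definition metricE :=
  (metricDl, metricDr, metricNl, metricNr, metricZl, metricZr).

Lemma metric_appE (X Y : vfield M) q :
  metric_app g X Y q = g q (X \at q) (Y \at q).
Proof. by []. Qed.

Variable D : connection M.
Hypothesis lcD : levi_civita g D.
Implicit Types (X Y Z W : vfield M).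

(** [X], [Y], [Z] are fields and not vectors because [curvature] differentiates
    them. *)
Definition riem4 (q : M) X Y Z W : R :=
  g q (curvature D X Y Z \at q) (W \at q).

(** Skewness in the last pair comes from evaluating $[X,Y]$ on the function
    $g(Z,W)$; the Bianchi identity is the Jacobi identity, written with the
    torsion-free connection. *)
Lemma riem4_curvature_like q : curvature_like (riem4 q).
Proof.
have [tor met] := lcD.
have skl X Y Z : curvature D X Y Z = - curvature D Y X Z.
  by rewrite /curvature (lie_skew X) covNl; vfield_ring.
split.
- move=> X X' Y Z W; rewrite /riem4 -metricDl -at_add; congr (g q (_ \at q) _).
  rewrite /curvature lie_addl !covDl cov_addr.
  by vfield_ring.
- by move=> X Y Z W; rewrite /riem4 skl at_opp metricNl.
- move=> X Y Z W; rewrite /riem4.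
  have := congr1 (fun h : sfun M => h q) (lieE X Y (metric_app g Z W)).
  rewrite !met !vfield_add !met.
  rewrite !sfunE !metric_appE.
  rewrite /curvature !at_add !at_opp !metricE !(metric_sym g (Z \at q)).
  by move=> ?; lra.
- move=> X Y Z W; rewrite /riem4 -!metricDl -!at_add.
  suff -> : curvature D X Y Z + curvature D Y Z X + curvature D Z X Y = 0.
    by rewrite [0 \at q](_ : _ = 0) ?metric0l //; apply/val_inj/funext.
  rewrite /curvature -(jacobi X Y Z).
  rewrite -(tor X (lie Y Z)) -(tor Y (lie Z X)) -(tor Z (lie X Y)).
  rewrite -!tor !cov_addr !covNr.
  by vfield_ring.
Qed.
End Metric.

(** * Sasakian identities *)

Section Sasakian.
Variables (R : realType) (m : nat) (N : manifold R (2 * m).+1).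
Variable S : sasakian N.
Local Notation g := (smetric S).
Local Notation D := (sconn S).
Local Notation phi := (sphi S).
Local Notation eta := (seta S).
Local Notation xi := (sxi S).
Implicit Types (X Y Z W : vfield N) (q : N).

Lemma eta_metric q (u : tangent q) : eta q u = g q u (xi \at q).
Proof.
have := smetric_phi S u (xi \at q).
by rewrite sphi_xi metric0r seta_xi mulr1; lra.
Qed.

Lemma metric_xi q : g q (xi \at q) (xi \at q) = 1.
Proof. by rewrite -eta_metric seta_xi. Qed.

Lemma eta_phi q (u : tangent q) : eta q (phi q u) = 0.
Proof.
have := sphi_sq S (phi q u).
rewrite (sphi_sq S u) linearD linearN linearZ sphi_xi /= scaler0 addr0 => e.
have := congr1 (eta q) e.
by rewrite linearD linearN linearZ seta_xi /= /GRing.scale /=; lra.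
Qed.

Lemma phi_skew q (u v : tangent q) : g q (phi q u) v = - g q u (phi q v).
Proof.
have := smetric_phi S (phi q u) v.
rewrite (sphi_sq S u) !metricE eta_phi mul0r subr0.
by rewrite (metric_sym g (xi \at q)) -eta_metric eta_phi mulr0 addr0.
Qed.

Lemma metric_phi_self q (u : tangent q) : g q u (phi q u) = 0.
Proof. by have := phi_skew u u; rewrite metric_sym; lra. Qed.

(** Differentiating $\phi\xi = 0$ gives $\phi\widetilde\nabla_X\xi = X - \eta(X)\xi$,
    and $\widetilde\nabla_X\xi$ is horizontal as $\xi$ has constant length; so
    applying $\phi$ once more determines it. *)
Lemma cov_xi X : D X xi = - endo_app phi X.
Proof.
apply: vfield_ext => q; rewrite at_opp at_endo.
have [_ met] := sconnP S.
have eta0 : eta q (D X xi \at q) = 0.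
  rewrite eta_metric.
  have := congr1 (fun h : sfun N => h q) (met X xi xi).
  have -> : metric_app g xi xi = 1.
    by apply: sfun_ext => q'; rewrite metric_appE metric_xi.
  have -> : X 1 = 0.
    have [_ /(_ 1 1)] := vfieldP X; rewrite !mulr1 mul1r => /eqP.
    by rewrite -subr_eq subrr => /eqP <-.
  by rewrite sfun_zeroE sfun_addE !metric_appE (metric_sym g (xi \at q)); lra.
have := sphi_sq S (D X xi \at q); rewrite eta0 scale0r addr0.
have phixi : endo_app phi xi = 0.
  by apply: vfield_ext => q'; rewrite at_endo sphi_xi; apply/val_inj/funext.
have := congr1 (fun Y => Y \at q) (scov_phi S X xi).
rewrite phixi.
have -> : D X 0 = 0 by apply: (addIr (D X 0)); rewrite -cov_addr !add0r.
rewrite !at_add !at_opp at_endo !at_fscale.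
have -> : form_app eta xi q = 1 by exact: seta_xi.
rewrite scale1r.
rewrite [0 \at q](_ : _ = 0) ?add0r; last exact/val_inj/funext.
move=> /(congr1 (phi q)) /=.
rewrite !(linearN, linearD, linearZ) /= sphi_xi scaler0 add0r.
move=> /oppr_inj -> ->.
by rewrite opprK.
Qed.

(** The Ricci identity for $\phi$, paired with $\phi W$.  Differentiating
    $(\widetilde\nabla_Y\phi)Z = g(Y,Z)\xi - \eta(Z)Y$ once more, the terms along
    $\xi$ are killed by the pairing, and the derivatives of $\xi$ and $\eta$ are
    given by $\widetilde\nabla\xi = -\phi$. *)
Lemma curvature_phi q X Y Z W : eta q (W \at q) = 0 ->
  riem4 g D q X Y (endo_app phi Z) (endo_app phi W) = riem4 g D q X Y Z W
    + g q (Y \at q) (phi q (Z \at q)) * g q (X \at q) (phi q (W \at q))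
    - g q (X \at q) (phi q (Z \at q)) * g q (Y \at q) (phi q (W \at q))
    + g q (X \at q) (Z \at q) * g q (Y \at q) (W \at q)
    - g q (Y \at q) (Z \at q) * g q (X \at q) (W \at q).
Proof.
move=> etaW; have [tor met] := sconnP S.
pose w := phi q (W \at q).
have nabla A B : D A (endo_app phi B) = endo_app phi (D A B) +
    metric_app g A B *^ xi - form_app eta B *^ A.
  by apply: (addIr (- endo_app phi (D A B))); rewrite scov_phi; vfield_ring.
have etaX (A B : vfield N) :
    A (form_app eta B) q =
      form_app eta (D A B) q + g q (A \at q) (phi q (B \at q)).
  have etaE C : form_app eta C = metric_app g C xi.
    by apply: sfun_ext => q'; exact: eta_metric.
  rewrite !etaE met cov_xi sfun_addE !metric_appE at_opp at_endo metricNr.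
  by rewrite -phi_skew (metric_sym g (A \at q)).
have xiw : g q (xi \at q) w = 0 by rewrite metric_sym -eta_metric eta_phi.
have phiw B : g q (phi q (B \at q)) w = g q (B \at q) (W \at q).
  by rewrite smetric_phi etaW mulr0 subr0.
rewrite /riem4 at_endo -/w /curvature !nabla -!tor.
rewrite !(cov_addr, covNr, cov_leibniz, nabla, covDl, covNl) !cov_xi.
rewrite !(at_add, at_opp, at_fscale, at_endo) !metricE xiw !phiw.
rewrite !etaX !metric_appE !linearB /= !metricE !phiw.
by ring.
Qed.

Variable q : N.
Local Notation "<< X , Y >>" := (g q (X \at q) (Y \at q)).
Local Notation J := (endo_app phi).

(** The curvature tensor of the unit sphere. *)
Definition constant4 X Y Z W : R :=
  << Y, Z >> * << X, W >> - << X, Z >> * << Y, W >>.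

(** The curvature tensor of complex projective space with holomorphic sectional
    curvature 4, for the complex structure that $\phi$ induces on $\ker\eta$. *)
Definition holomorphic4 X Y Z W : R :=
  constant4 X Y Z W + << X, J Z >> * << J Y, W >>
  - << Y, J Z >> * << J X, W >> + 2 * << X, J Y >> * << J Z, W >>.

Lemma constant4_curvature_like : curvature_like constant4.
Proof.
split=> [X X' Y Z W|X Y Z W|X Y Z W|X Y Z W]; rewrite /constant4.
- by rewrite !at_add !metricE; ring.
- by ring.
- by ring.
- rewrite (metric_sym g (Z \at q) (X \at q)) (metric_sym g (Z \at q) (Y \at q)).
  by rewrite (metric_sym g (Y \at q) (X \at q)); ring.
Qed.

Lemma holomorphic4_curvature_like : curvature_like holomorphic4.
Proof.
have Jskew X Y : << J X, Y >> = - << X, J Y >> by rewrite !at_endo phi_skew.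
have Jswap X Y : << Y, J X >> = - << X, J Y >>.
  by rewrite -Jskew metric_sym.
have [d l r b] := constant4_curvature_like.
split=> [X X' Y Z W|X Y Z W|X Y Z W|X Y Z W]; rewrite /holomorphic4.
- by rewrite d !at_endo !at_add !linearD !metricE; ring.
- by rewrite l (Jswap X Y); ring.
- by rewrite r !Jskew (Jswap Z W); ring.
- transitivity (constant4 X Y Z W + constant4 Y Z X W + constant4 Z X Y W);
    last exact: b.
  by rewrite !Jskew (Jswap X Z) (Jswap X Y) (Jswap Y Z); ring.
Qed.

(** The curvature of a Sasakian space form on the contact distribution.  The
    difference [B] of the two sides is of Kaehler type on the fields that are
    horizontal at [q], and its holomorphic sectional curvatures vanish, because
    those of $\widetilde R$, [constant4] and [holomorphic4] are $c$, $1$ and $4$. *)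
Lemma horizontal_curvature (c : R) (Sc : space_form S c) X Y Z W :
  eta q (X \at q) = 0 -> eta q (Y \at q) = 0 ->
  eta q (Z \at q) = 0 -> eta q (W \at q) = 0 ->
  riem4 g D q X Y Z W =
    constant4 X Y Z W + (c - 1) / 4 * holomorphic4 X Y Z W.
Proof.
pose B X Y Z W := riem4 g D q X Y Z W - constant4 X Y Z W
  - (c - 1) / 4 * holomorphic4 X Y Z W.
have cR := riem4_curvature_like (sconnP S) q.
have cB : curvature_like B.
  exact: curvature_like_lin cR constant4_curvature_like
    holomorphic4_curvature_like.
pose H U := eta q (U \at q) = 0.
suff B0 : H X -> H Y -> H Z -> H W -> B X Y Z W = 0.
  by move=> hX hY hZ hW; have := B0 hX hY hZ hW; rewrite /B; lra.
have HJ U : H U -> H (J U) by rewrite /H at_endo eta_phi.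
have atJJ U : H U -> J (J U) \at q = - U \at q.
  by move=> hU; rewrite !at_endo sphi_sq hU scale0r addr0.
have isoJ U V : H V -> << J U, J V >> = << U, V >>.
  by move=> hV; rewrite !at_endo smetric_phi hV mulr0 subr0.
have Jskew U V : << J U, V >> = - << U, J V >> by rewrite !at_endo phi_skew.
have B4 U1 U2 U3 V V' (e : V \at q = V' \at q) :
    B U1 U2 U3 V = B U1 U2 U3 V'.
  by rewrite /B /riem4 /holomorphic4 /constant4 e.
have B1 := cl_local cB B4.
apply: (kaehler_eq0 cB (H := H) (J := J)).
- by move=> U V; rewrite /H at_add linearD /= => -> ->; rewrite addr0.
- by move=> U; rewrite /H at_opp linearN /= => ->; rewrite oppr0.
- exact: HJ.
- by move=> U V; apply: vfield_ext => q'; rewrite !(at_endo, at_add) linearD.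
- by move=> U; apply: vfield_ext => q'; rewrite !(at_endo, at_opp) linearN.
- move=> U V1 V2 V3 hU; rewrite -(clNl cB); apply: B1.
  by rewrite atJJ // at_opp.
- move=> U1 U2 U3 U4 h3 h4.
  rewrite /B curvature_phi // /holomorphic4 /constant4.
  rewrite !isoJ // !Jskew !atJJ // -!at_endo !metricNr.
  by ring.
move=> U hU.
(* constancy of the curvature says nothing about a field that vanishes at [q],
   which locality covers *)
have [U0|U0] := eqVneq (U \at q) 0.
  have := B4 U (J U) (J U) U (- U); rewrite at_opp U0 oppr0 (clN4 cB).
  by move=> /(_ erefl); lra.
have hJU := HJ _ hU.
rewrite /B /riem4 /holomorphic4 /constant4 !isoJ // !Jskew !atJJ //.
rewrite at_endo !metricNr metric_phi_self.
have rU : curvature_at D (U \at q) (phi q (U \at q)) (phi q (U \at q))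
    (curvature D U (J U) (J U) \at q).
  by exists U, (J U), (J U); split; rewrite ?at_endo.
have := Sc q (U \at q) _ U0 hU rU.
rewrite /sectional metric_phi_self smetric_phi hU mulr0 subr0 expr0n subr0.
have gt0 : 0 < << U, U >> by exact: metric_pos.
move=> /(canRL (divfK _)) -> //; last by rewrite mulf_neq0 // gt_eqF.
by field.
Qed.

End Sasakian.

Theorem lemma7p1 (R : realType) (m k : nat) (N : manifold R (2 * m).+1)
    (S : sasakian N) (c : R) (Sc : space_form S c) (M : manifold R k)
    (f : immersion M N) (A : ptr S f) (PF : phi_split S f) (X Z : vfield M)
    (DX : section_of (@ambiguous R k m M N S f A) X)
    (DZ : section_of (@ptr_perp R k m M N S f A) Z)
    (p : M) (r : tangent (f p))
    (Rr : curvature_at (sconn S)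
            (differential f (X \at p)) (differential f (phiP PF (X \at p)))
            (differential f (Z \at p)) r) :
  smetric S (f p) r (sphi S (f p) (differential f (Z \at p))) =
  - ((c - 1) / 2)
    * riem_norm (smetric S) (differential f (phiP PF (X \at p))) ^+ 2
    * riem_norm (smetric S) (differential f (Z \at p)) ^+ 2.
Proof.
have [Xxi Xperp] := DX p; have Zperp := DZ p.
have Zeta := ptr_perp_eta Zperp; have Znormal := ptr_perp_phi Zperp.
have Xeta : seta S (f p) (differential f (X \at p)) = 0.
  by rewrite eta_metric.
have XZ := Xperp _ Zperp.
have splitX := phi_splitP PF (X \at p).
have Fnormal := phiF_normal PF (X \at p).
set u := differential f (X \at p) in Rr Xeta XZ splitX *.
set v := differential f (phiP PF (X \at p)) in Rr splitX *.
set w := differential f (Z \at p) in Rr Zeta XZ Znormal *.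
(* $PX = \phi X - FX$ is horizontal: $\phi X$ is, and $FX$ is normal while
   $\xi$ is tangent *)
have Peta : seta S (f p) v = 0.
  have [t xit] := ptr_xi A p.
  have : seta S (f p) (sphi S (f p) u) = 0 by exact: eta_phi.
  by rewrite splitX !eta_metric metricDl -xit (Fnormal t) addr0.
have uw : smetric S (f p) u (sphi S (f p) w) = 0.
  by rewrite (metric_sym (smetric S)); exact: Znormal.
have vw : smetric S (f p) v (sphi S (f p) w) = 0.
  by rewrite (metric_sym (smetric S)); exact: Znormal.
have uv : smetric S (f p) u (sphi S (f p) v) = - smetric S (f p) v v.
  by apply: oppr_inj; rewrite -phi_skew splitX metricDl (Fnormal _) addr0 opprK.
have ww : smetric S (f p) (sphi S (f p) w) (sphi S (f p) w) =
    smetric S (f p) w w.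
  by rewrite smetric_phi Zeta mulr0 subr0.
case: Rr => X0 [Y0 [Z0 [eX eY eZ <-]]].
have -> : sphi S (f p) w = endo_app (sphi S) Z0 \at (f p) by rewrite at_endo eZ.
have := horizontal_curvature Sc (q := f p) (X := X0) (Y := Y0) (Z := Z0)
  (W := endo_app (sphi S) Z0).
rewrite /riem4 at_endo eX eY eZ eta_phi => /(_ Xeta Peta Zeta erefl) ->.
rewrite /holomorphic4 /constant4 !at_endo eX eY eZ XZ uw vw uv ww.
have norm2 (t : tangent (f p)) :
    riem_norm (smetric S) t ^+ 2 = smetric S (f p) t t.
  rewrite sqr_sqrtr //; have [->|t0] := eqVneq t 0; first by rewrite metric0l.
  exact/ltW/metric_pos.
rewrite !norm2.
by field.
Qed.
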